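(* Let $d\in\{1,2,\dots\}$, let $X$ be a splittable stationary random field on $\mathbb{R}^d$, let $\varphi:\mathbb{R}^d\to\mathbb{R}$ be continuous and compactly supported, and let $\sigma_X\in[0,\infty)$ be the number defined in the context. If $\|\varphi\|\sigma_X\ne0$, where $\|\varphi\|^2=\int_{\mathbb{R}^d}\varphi^2(t)\,dt$, then $$\lim_{\substack{r\to\infty,\ c\to\infty\\ (c\log^d r)^2/r^d\to0}}\ \frac1{c^2}\log\mathbb{P}\Big(\int_{\mathbb{R}^d}\varphi\Big(\frac1rt\Big)X_t\,dt\ge c\,\|\varphi\|\,\sigma_X\,r^{d/2}\Big)=-\frac12 .$$
   Context: Random fields. A locally finite signed Borel measure (LFSBM) on $\mathbb{R}^d$ is a real-valued set function on the bounded Borel subsets of $\mathbb{R}^d$ whose restriction to the Borel subsets of any bounded Borel set is a (countably additive, finite) signed measure. The set of LFSBMs carries the $\sigma$-field generated by the maps $\mu\mapsto\int f\,d\mu$, $f$ continuous with compact support. A random field $X$ on $\mathbb{R}^d$ (and on a probability space $\Omega$) is a measurable map from $\Omega$ to the space of LFSBMs on $\mathbb{R}^d$; it is denoted as if it had a density: $B\mapsto\int_B X_t\,dt$. The (random, positive, locally finite) variation measure is denoted $B\mapsto\int_B|X_t|\,dt$; it extends to all Borel sets with values in $[0,\infty]$. For locally bounded Borel $\varphi$, $\varphi X=(\varphi(t)X_t)_t$ is the measure with density $\varphi$ relative to $X$. For a coordinate permutation composed with a shift, $\alpha:\mathbb{R}^d\to\mathbb{R}^d$, the field $(X_{\alpha(t)})_t$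 is defined by $\int_B X_{\alpha(t)}\,dt=\int_{\alpha(B)}X_t\,dt$. $X$ is stationary if $(X_{t+s})_t$ has the same distribution as $X$ for every $s\in\mathbb{R}^d$. Identically distributed fields may live on different probability spaces. Split and leak. A split of a random field $X$ on $\mathbb{R}^d$ is a triple $(X^0,X^-,X^+)$ of random fields on $\mathbb{R}^d$, all defined on one probability space $\tilde\Omega$ (possibly different from that of $X$), such that $X^-,X^+$ are independent and each of $X^0,X^-,X^+$ is distributed like $X$. Its leak is the random field $Y$ on $\tilde\Omega$ with $Y_t=X^-_t-X^0_t$ when $t_1<0$ and $Y_t=X^+_t-X^0_t$ when $t_1\ge0$ (equality of measures on the two half-spaces). A random field $Y$ on any probability space is a leak for $X$ if it is distributed like the leak of some split of $X$. Splittability. Let $k\in\{1,\dots,d\}$. A random field $X$ on $\mathbb{R}^d$ is $(1,k)$-splittable (recursively in $k$) if: (a) for every $s\in\mathbb{R}^k$, $\mathbb{E}\exp\int_{([0,1)^k+s)\times\mathbb{R}^{d-k}}|X_t|\,dt\le2$; (b) $\mathbb{E}\int_A X_t\,dt=0$ for every bounded Borel $A\subset\mathbb{R}^d$; (c) for every $i\in\{1,\dots,k\}$ and $r\in\mathbb{R}$ the random field $\tilde X_{t_1,\dots,t_d}=X_{t_2,\dots,t_i,t_1+r,t_{i+1},\dots,t_d}$ has a leak $\tilde Y$ such that the random field $Y_{t_1,\dots,t_d}=\tilde Y_{t_k,t_1,\dots,t_{k-1},t_{k+1},\dots,t_d}$ is $(1,k-1)$-splittable if $k>1$, and satisfies $\mathbb{E}\exp\int_{\mathbb{R}^d}|Y_t|\,dt\le2$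 if $k=1$. For $C\in(0,\infty)$, $X$ is $(C,k)$-splittable if $\frac1CX$ is $(1,k)$-splittable; $X$ is $C$-splittable if it is $(C,d)$-splittable; $X$ is splittable if it is $C$-splittable for some $C\in(0,\infty)$. The number $\sigma_X$. For a splittable stationary $X$, $\sigma_X$ is the unique number in $[0,\infty)$ such that for every continuous compactly supported $\varphi:\mathbb{R}^d\to\mathbb{R}$, $\frac1{r^d\lambda^2}\log\mathbb{E}\exp\big(\lambda\int_{\mathbb{R}^d}\varphi(\frac1rt)X_t\,dt\big)\to\frac12\|\varphi\|^2\sigma_X^2$ as $r\to\infty$, $\lambda\to0$ ($\lambda\in\mathbb{R}\setminus\{0\}$), $\lambda\log^d r\to0$. Its existence is another theorem of the same paper and is part of the setting here. Limits. The joint limit in the claim means: for every $\eta>0$ there are $R,\delta>0$ such that the expression is within $\eta$ of the limit whenever $r>R$, $c>R$ and $(c\log^d r)^2/r^d<\delta$; similarly for the limit defining $\sigma_X$ (with $r>R$, $0<|\lambda|<\delta$, $|\lambda|\log^dr<\delta$). Here $\log^d r=(\log r)^d$. *)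

(* Defs.v *)
From HB Require Import structures.
From mathcomp Require Import all_boot all_order all_algebra all_fingroup.
From mathcomp Require Import zify.
From mathcomp Require Import all_classical all_reals all_analysis.
From mathcomp Require Import measurable_realfun.

Set Implicit Arguments.
Unset Strict Implicit.
Unset Printing Implicit Defensive.

Import Order.TTheory GRing.Theory Num.Theory.
Import numFieldNormedType.Exports.

Local Open Scope classical_set_scope.
Local Open Scope ring_scope.

Section borel.
Context {R : realType} (m n : nat).

HB.instance Definition _ := @isMeasurable.Build (sigma_display (@open 'M[R]_(m, n)))
  'M[R]_(m, n) <<s @open 'M[R]_(m, n) >> (@sigma_algebra0 _ setT _)
  (@sigma_algebraC _ _) (@sigma_algebra_bigcup _ setT _).

End borel.

Lemma open_measurable_mx (R : realType) m n (U : set 'M[R]_(m, n)) :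
  open U -> measurable U.
Proof. exact: sub_sigma_algebra. Qed.


Lemma continuous_measurable_preimage (R : realType) m n m' n'
    (f : 'M[R]_(m, n) -> 'M[R]_(m', n')) :
  continuous f -> forall A, measurable A -> measurable (f @^-1` A).
Proof.
move=> /continuousP cf A mA.
have : measurable_fun setT f.
  apply: (@measurability _ _ _ _ _ _ (@open 'M[R]_(m', n'))) => //.
  by move=> _ [U oU <-]; rewrite setTI; apply: open_measurable_mx; exact: cf.
by move=> /(_ measurableT A mA); rewrite setTI.
Qed.

Definition bounded_borel (R : realType) d (B : set 'rV[R]_d) : Prop :=
  measurable B /\ bounded_set B.

Lemma bounded_setW (R : realType) d (A B : set 'rV[R]_d) :
  A `<=` B -> bounded_set B -> bounded_set A.
Proof.
move=> AB [M [Mr MB]]; exists M; split => // x Mx t At; exact: (MB x Mx t (AB _ At)).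
Qed.

Lemma bounded_borelI (R : realType) d (A B : set 'rV[R]_d) :
  measurable A -> bounded_borel B -> bounded_borel (A `&` B).
Proof.
move=> mA [mB bB]; split; first exact: measurableI.
exact: bounded_setW bB.
Qed.

Definition sigma_additive_bounded (R : realType) d (mu : set 'rV[R]_d -> R) :=
  forall F : (set 'rV[R]_d)^nat, (forall i, measurable (F i)) ->
    trivIset setT F -> bounded_borel (\bigcup_n F n) ->
    (fun n => \sum_(0 <= i < n) mu (F i)) @ \oo --> mu (\bigcup_n F n).

(* A locally finite signed Borel measure is only defined on bounded Borel sets;
   it is represented by its extension by 0 to all sets, so that Leibniz equality
   is equality of set functions on bounded Borel sets. *)
Record lfsbm (R : realType) (d : nat) := Lfsbm {
  lfsbm_val :> set 'rV[R]_d -> R ;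
  _ : sigma_additive_bounded lfsbm_val ;
  _ : forall B, ~ bounded_borel B -> lfsbm_val B = 0 }.

Section lfsbm_theory.
Context {R : realType} {d : nat}.
Implicit Types (mu : lfsbm R d) (A B : set 'rV[R]_d).

Lemma lfsbm_sigma_additive mu : sigma_additive_bounded mu.
Proof. by case: mu. Qed.

Lemma lfsbm_out mu B : ~ bounded_borel B -> mu B = 0.
Proof. by case: mu => ? ? h; exact: h. Qed.

Lemma lfsbm0 mu : mu set0 = 0.
Proof.
have b0 : bounded_borel (set0 : set 'rV[R]_d).
  by split; [exact: measurable0|exists 0; split => // x _ t []].
have /(_ (fun=> set0)) := lfsbm_sigma_additive (mu := mu).
rewrite bigcup0// => /(_ (fun=> measurable0) (@trivIset_set0 _ _ _) b0) h.
have {}h : (fun n => mu set0 *+ n) @ \oo --> mu set0.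
  apply: cvg_trans h; apply: near_eq_cvg; apply: nearW => n.
  by rewrite sumr_const_nat subn0.
have h' : (fun n => mu set0 *+ n.+1) @ \oo --> mu set0.
  by rewrite -(@cvg_shiftS _ (fun n => mu set0 *+ n)) in h.
have hc : (fun n => mu set0 *+ n.+1 - mu set0 *+ n) @ \oo --> mu set0.
  by under eq_fun do rewrite mulrS addrK; exact: cvg_cst.
rewrite -[LHS](cvg_lim (@Rhausdorff R) hc); apply: (cvg_lim (@Rhausdorff R)).
by rewrite -(subrr (mu set0)); exact: cvgB h' h.
Qed.

Definition extend_by_0 (f : set 'rV[R]_d -> R) (B : set 'rV[R]_d) : R :=
  if pselect (bounded_borel B) then f B else 0.

Lemma extend_by_0E f B : bounded_borel B -> extend_by_0 f B = f B.
Proof. by rewrite /extend_by_0; case: pselect. Qed.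

Lemma extend_by_0_sigma_additive f :
  sigma_additive_bounded f -> sigma_additive_bounded (extend_by_0 f).
Proof.
move=> sf F mF tF bF; rewrite extend_by_0E//.
rewrite [X in X @ _ --> _](_ : _ = fun n => \sum_(0 <= i < n) f (F i)).
  exact: sf.
apply/funext => n; apply: eq_bigr => i _; rewrite extend_by_0E//.
split; first exact: mF.
by case: bF => _; apply: bounded_setW; exact: bigcup_sup.
Qed.

Lemma extend_by_0_out f B : ~ bounded_borel B -> extend_by_0 f B = 0.
Proof. by rewrite /extend_by_0; case: pselect. Qed.

Definition mk_lfsbm f (sf : sigma_additive_bounded f) : lfsbm R d :=
  Lfsbm (extend_by_0_sigma_additive sf) (@extend_by_0_out f).

Section restriction.
Variables (mu : lfsbm R d) (B : set 'rV[R]_d) (bB : bounded_borel B).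

Definition lfsbm_restr of bounded_borel B :=
  fun A : set 'rV[R]_d => (mu (A `&` B))%:E.

Let restr0 : lfsbm_restr bB set0 = 0%E.
Proof. by rewrite /lfsbm_restr set0I lfsbm0. Qed.

Let restr_fin A : measurable A -> lfsbm_restr bB A \is a fin_num.
Proof. by []. Qed.

Let restr_sigma_additive : semi_sigma_additive (lfsbm_restr bB).
Proof.
move=> F mF tF mU; rewrite /lfsbm_restr setI_bigcupl.
under eq_fun do rewrite sumEFin.
apply: cvg_EFin; first exact: nearW.
apply: (lfsbm_sigma_additive (mu := mu) (F := fun i => F i `&` B)).
- by move=> i; apply: measurableI => //; case: bB.
- exact: trivIset_setIr.
- by rewrite -setI_bigcupl; exact: bounded_borelI.
Qed.

HB.instance Definition _ := isCharge.Build _ _ _ (lfsbm_restr bB)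
  restr0 restr_fin restr_sigma_additive.

End restriction.

Definition annulus (k : nat) : set 'rV[R]_d :=
  [set t | k%:R <= `|t| < k.+1%:R].

Lemma bounded_borel_annulus k : bounded_borel (annulus k).
Proof.
have mlt (r : R) : measurable [set t : 'rV[R]_d | `|t| < r].
  apply: open_measurable_mx.
  by have /continuousP/(_ _ (@open_lt R r)) := @norm_continuous R 'rV[R]_d.
split.
  rewrite (_ : annulus k = ~` [set t | `|t| < k%:R] `&` [set t | `|t| < k.+1%:R]).
    by apply: measurableI => //; exact: measurableC.
  apply/seteqP; split => t /=.
    by move=> /andP[kt tk]; split => //; apply/negP; rewrite -leNgt.
  by move=> [/negP kt tk]; rewrite /annulus/= leNgt kt.
exists k.+1%:R; split => // x kx t /andP[_ tk].
exact/ltW/(lt_trans tk).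
Qed.

End lfsbm_theory.

Section hahn_choice.
Context {disp} {T : measurableType disp} {R : realType}.
Variable nu : {charge set T -> \bar R}.

Definition hahn_pos : set T := sval (cid (Hahn_decomposition nu)).

Definition hahn_neg : set T :=
  sval (cid (svalP (cid (Hahn_decomposition nu)))).

Lemma hahn_posneg : hahn_decomposition nu hahn_pos hahn_neg.
Proof. exact: (svalP (cid (svalP (cid (Hahn_decomposition nu))))). Qed.

End hahn_choice.

(* The annuli form a countable partition of the whole space into bounded Borel
   sets.  As the Jordan decomposition is compatible with restriction to Borel
   subsets, summing it over the annuli yields the positive and negative parts
   and the variation measure of mu, as (possibly infinite) measures on the
   whole space. *)
Section lfsbm_integral.
Context {R : realType} {d : nat}.
Implicit Type mu : lfsbm R d.

Let piece mu k := lfsbm_restr mu (@bounded_borel_annulus R d k).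

Definition lfsbm_pos mu : {measure set 'rV[R]_d -> \bar R} :=
  mseries (fun k => jordan_pos (hahn_posneg (piece mu k))) 0.

Definition lfsbm_neg mu : {measure set 'rV[R]_d -> \bar R} :=
  mseries (fun k => jordan_neg (hahn_posneg (piece mu k))) 0.

Definition lfsbm_variation mu : {measure set 'rV[R]_d -> \bar R} :=
  mseries (fun k => charge_variation (hahn_posneg (piece mu k))) 0.

Definition lfsbm_int mu (f : 'rV[R]_d -> R) : R :=
  \int[lfsbm_pos mu]_t f t - \int[lfsbm_neg mu]_t f t.

End lfsbm_integral.

Definition Cc (R : realType) (d : nat) : set ('rV[R]_d -> R) :=
  [set f | continuous f /\ compact (closure [set t | f t != 0])].
Arguments Cc : clear implicits.

Section lfsbm_measurable.
Context {R : realType} {d : nat}.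

Lemma sigma_additive_bounded0 : @sigma_additive_bounded R d (fun=> 0).
Proof. by move=> F _ _ _; under eq_fun do rewrite big1//; exact: cvg_cst. Qed.

HB.instance Definition _ := gen_eqMixin (lfsbm R d).
HB.instance Definition _ := gen_choiceMixin (lfsbm R d).
HB.instance Definition _ := isPointed.Build (lfsbm R d)
  (mk_lfsbm sigma_additive_bounded0).

Definition lfsbm_generator : set (set (lfsbm R d)) :=
  [set A | exists2 f, Cc R d f &
     exists2 B : set R, measurable B & A = [set mu | B (lfsbm_int mu f)]].

HB.instance Definition _ := @isMeasurable.Build (sigma_display lfsbm_generator)
  (lfsbm R d) <<s lfsbm_generator >> (@sigma_algebra0 _ setT _)
  (@sigma_algebraC _ _) (@sigma_algebra_bigcup _ setT _).

End lfsbm_measurable.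

Section lfsbm_operations.
Context {R : realType}.

Lemma scale_sigma_additive d (c : R) (mu : lfsbm R d) :
  sigma_additive_bounded (fun B => c * mu B).
Proof.
move=> F mF tF bF; under eq_fun do rewrite -mulr_sumr.
by apply: cvgMr; exact: lfsbm_sigma_additive.
Qed.

Definition lfsbm_scale d (c : R) (mu : lfsbm R d) : lfsbm R d :=
  mk_lfsbm (@scale_sigma_additive d c mu).

Definition perm_shift d (s : 'S_d) (v : 'rV[R]_d) (t : 'rV[R]_d) : 'rV[R]_d :=
  col_perm s t + v.

Lemma perm_shiftE d (s : 'S_d) (v t : 'rV[R]_d) j :
  perm_shift s v t 0 j = t 0 (s j) + v 0 j.
Proof. by rewrite !mxE. Qed.

Lemma perm_shift_continuous d (s : 'S_d) (v : 'rV[R]_d) :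
  continuous (perm_shift s v).
Proof.
have cs : continuous (col_perm s : 'rV[R]_d -> 'rV[R]_d).
  move=> t A /nbhs_ballP[e e0 eA]; apply/nbhs_ballP; exists e => // u [_ tu].
  by apply: eA; split => // i j; rewrite !mxE; exact: tu.
by move=> t; exact: (cvgD (cs t) (cvg_cst v)).
Qed.

Lemma perm_shiftVK d (s : 'S_d) (v : 'rV[R]_d) (t : 'rV[R]_d) :
  perm_shift s v (perm_shift (s^-1)%g (- col_perm (s^-1)%g v) t) = t.
Proof. by apply/rowP => j; rewrite !mxE permK subrK. Qed.

Lemma perm_shiftK d (s : 'S_d) (v : 'rV[R]_d) (t : 'rV[R]_d) :
  perm_shift (s^-1)%g (- col_perm (s^-1)%g v) (perm_shift s v t) = t.
Proof. by apply/rowP => j; rewrite !mxE permKV addrK. Qed.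

Lemma perm_shift_image d (s : 'S_d) (v : 'rV[R]_d) (B : set 'rV[R]_d) :
  perm_shift s v @` B = perm_shift (s^-1)%g (- col_perm (s^-1)%g v) @^-1` B.
Proof.
apply/seteqP; split => [_ [t Bt <-]|t Bt] /=; first by rewrite perm_shiftK.
by exists (perm_shift (s^-1)%g (- col_perm (s^-1)%g v) t); rewrite ?perm_shiftVK.
Qed.

Lemma bounded_borel_perm_shift d (s : 'S_d) (v : 'rV[R]_d) (B : set 'rV[R]_d) :
  bounded_borel B -> bounded_borel (perm_shift s v @` B).
Proof.
move=> [mB /ex_strict_bound_gt0[M M0 BM]]; split.
  rewrite perm_shift_image; apply: continuous_measurable_preimage => //.
  exact: perm_shift_continuous.
exists (M + `|v|); split; [exact: num_real|move=> x Mx _ [t Bt <-]].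
apply: le_trans (ltW Mx); apply: le_trans (ler_normD _ _) _.
rewrite lerD2r; apply: le_trans (ltW (BM _ Bt)).
rewrite /Num.Def.normr/= !mx_normrE; apply: bigmax_le => [|i _].
  by apply/bigmax_geP; left.
by apply/bigmax_geP; right; exists (i.1, s i.2) => //=; rewrite !mxE.
Qed.

Lemma reindex_sigma_additive d (s : 'S_d) (v : 'rV[R]_d) (mu : lfsbm R d) :
  sigma_additive_bounded (fun B => mu (perm_shift s v @` B)).
Proof.
move=> F mF tF bF; rewrite image_bigcup.
apply: (lfsbm_sigma_additive (mu := mu) (F := fun i => perm_shift s v @` F i)).
- move=> i; rewrite perm_shift_image.
  by apply: continuous_measurable_preimage => //; exact: perm_shift_continuous.
- apply/trivIsetP => i j _ _ ij; rewrite !perm_shift_image -preimage_setI.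
  by move/trivIsetP : tF => ->//; rewrite preimage_set0.
- by rewrite -image_bigcup; exact: bounded_borel_perm_shift.
Qed.

(* the measure with density t |-> X_(perm_shift s v t) *)
Definition lfsbm_reindex d (s : 'S_d) (v : 'rV[R]_d) (mu : lfsbm R d) : lfsbm R d :=
  mk_lfsbm (@reindex_sigma_additive d s v mu).

Definition halfspace_neg {d} : set 'rV[R]_d.+1 := [set t | t 0 0 < 0].
Definition halfspace_nonneg {d} : set 'rV[R]_d.+1 := [set t | 0 <= t 0 0].

Lemma measurable_halfspace_neg d : measurable (@halfspace_neg d).
Proof.
apply: open_measurable_mx.
by have /continuousP/(_ _ (@open_lt R 0)) := @coord_continuous R 1 d.+1 0 0.
Qed.

Lemma measurable_halfspace_nonneg d : measurable (@halfspace_nonneg d).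
Proof.
rewrite (_ : @halfspace_nonneg d = ~` halfspace_neg).
  by apply: measurableC; exact: measurable_halfspace_neg.
apply/seteqP; split => t /=; rewrite /halfspace_nonneg /halfspace_neg /=.
  by rewrite leNgt => /negP.
by move=> /negP; rewrite -leNgt.
Qed.

Lemma leak_sigma_additive d (X0 Xm Xp : lfsbm R d.+1) :
  sigma_additive_bounded (fun B => Xm (halfspace_neg `&` B) +
    Xp (halfspace_nonneg `&` B) - X0 B).
Proof.
move=> F mF tF bF; under eq_fun do rewrite sumrB big_split/=.
have aux (H : set 'rV[R]_d.+1) (mu : lfsbm R d.+1) : measurable H ->
    (fun n => \sum_(0 <= i < n) mu (H `&` F i)) @ \oo -->
    mu (H `&` \bigcup_n F n).
  move=> mH; rewrite setI_bigcupr.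
  apply: (lfsbm_sigma_additive (mu := mu) (F := fun i => H `&` F i)).
  - by move=> i; exact: measurableI.
  - exact: trivIset_setIl.
  - by rewrite -setI_bigcupr; exact: bounded_borelI.
apply: cvgB; last exact: lfsbm_sigma_additive.
apply: cvgD; apply: aux.
- exact: measurable_halfspace_neg.
- exact: measurable_halfspace_nonneg.
Qed.

Definition lfsbm_leak d (X0 Xm Xp : lfsbm R d.+1) : lfsbm R d.+1 :=
  mk_lfsbm (@leak_sigma_additive d X0 Xm Xp).

End lfsbm_operations.

(* Lebesgue measure on R^n, by recursion on n: the image of the product of the
   one-dimensional Lebesgue measure and Lebesgue measure on R^(n-1). *)
Section lebesgue_rV.
Context {R : realType}.

Definition cons_rV n (p : R * 'rV[R]_n) : 'rV[R]_n.+1 := row_mx p.1%:M p.2.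

Lemma open_rV_countable n (U : set 'rV[R]_n) : open U ->
  U = \bigcup_(p in [set p : 'rV[rat]_n * nat |
        ball (map_mx ratr p.1 : 'rV[R]_n) p.2.+1%:R^-1 `<=` U])
      ball (map_mx ratr p.1 : 'rV[R]_n) p.2.+1%:R^-1.
Proof.
move=> oU; apply/seteqP; split => [t Ut|t [p pU pt]]; last exact: pU.
have /nbhs_ballP[e e0 eU] := open_nbhs_nbhs (conj oU Ut).
have [k ke] : exists k : nat, k.+1%:R^-1 < e / 2 :> R.
  have := near_infty_natSinv_lt (PosNum (divr_gt0 e0 (ltr0n _ 2))).
  by move=> [k _ /(_ k (leqnn k))]; exists k.
have qP j : exists q : rat, ball (t 0 j) k.+1%:R^-1 (ratr q : R).
  have k0 : 0 < k.+1%:R^-1 :> R by [].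
  have := @rat_in_itvoo R (t 0 j - k.+1%:R^-1) (t 0 j + k.+1%:R^-1).
  rewrite ltrBlDr -addrA ltrDl addr_gt0// => /(_ isT)[q].
  rewrite in_itv/= => /andP[q1 q2]; exists q; rewrite /ball/= ltr_distlC.
  by rewrite q1.
pose q := \row_j sval (cid (qP j)).
have qt : ball (map_mx ratr q : 'rV[R]_n) k.+1%:R^-1 t.
  split => // i j; rewrite !mxE ord1; apply: ball_sym; exact: svalP (cid (qP j)).
exists (q, k) => //= u qu; apply: eU.
apply: (@le_ball _ _ _ (k.+1%:R^-1 + k.+1%:R^-1)).
  by rewrite [leRHS](splitr e); apply: lerD; exact: ltW.
by apply: ball_triangle qu; exact: ball_sym.
Qed.

Lemma measurable_fun_rV disp (T : measurableType disp) n (f : T -> 'rV[R]_n) :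
  (forall j, measurable_fun setT (fun x => f x 0 j)) -> measurable_fun setT f.
Proof.
move=> mf; apply: (@measurability _ _ _ _ _ _ (@open 'rV[R]_n)) => //.
move=> _ [U /open_rV_countable -> <-]; rewrite setTI preimage_bigcup.
rewrite bigcup_mkcond; apply: countable_bigcupT_measurable => //.
move=> -[q k] /=; case: ifPn => // _.
rewrite (_ : _ @^-1` _ = \bigcap_(j in [set: 'I_n])
   ((fun x => f x 0 j) @^-1` (ball (ratr (q 0 j) : R) k.+1%:R^-1))).
  apply: fin_bigcap_measurable => // j _.
  rewrite -[X in measurable X]setTI; apply: mf => //.
  by rewrite ball_itv; exact: measurable_itv.
apply/seteqP; split => [x [_ h] j _|x h]; first by have := h 0 j; rewrite mxE.
by split => // i j; rewrite mxE ord1; exact: h.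
Qed.

Lemma measurable_coord n (j : 'I_n) :
  measurable_fun setT (fun v : 'rV[R]_n => v 0 j).
Proof.
apply: (measurability _ (RGenOpens.measurableE R)).
move=> _ [_ [a [b ->] <-]]; rewrite setTI; apply: open_measurable_mx.
by have /continuousP/(_ _ (@interval_open R (BRight a) (BLeft b) isT isT)) := @coord_continuous R 1 n 0 j.
Qed.

Lemma cons_rV0 n (p : R * 'rV[R]_n) : cons_rV p 0 0 = p.1.
Proof.
transitivity ((p.1%:M : 'M[R]_1) 0 0); last by rewrite mxE.
rewrite -(row_mxEl (p.1%:M : 'M[R]_1) p.2 0 0) /cons_rV; congr (row_mx _ _ _ _).
exact/val_inj.
Qed.

Lemma cons_rV_lift n (p : R * 'rV[R]_n) j : cons_rV p 0 (lift ord0 j) = p.2 0 j.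
Proof.
rewrite -(row_mxEr (p.1%:M : 'M[R]_1) p.2 0 j) /cons_rV; congr (row_mx _ _ _ _).
exact/val_inj.
Qed.

Lemma measurable_cons_rV n : measurable_fun setT (@cons_rV n).
Proof.
apply: measurable_fun_rV => j.
case: (unliftP ord0 j) => [j' ->|->].
  under eq_fun do rewrite cons_rV_lift.
  exact: (measurableT_comp (measurable_coord j') measurable_snd).
by under eq_fun do rewrite cons_rV0; exact: measurable_fst.
Qed.

Definition uncons_rV n (t : 'rV[R]_n.+1) : R * 'rV[R]_n :=
  (t 0 0, \row_j t 0 (lift ord0 j)).

Lemma cons_rVK n : cancel (@cons_rV n) (@uncons_rV n).
Proof.
move=> [x v]; rewrite /uncons_rV cons_rV0; congr pair.
by apply/rowP => j; rewrite mxE cons_rV_lift.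
Qed.

Lemma measurable_uncons_rV n : measurable_fun setT (@uncons_rV n).
Proof.
apply: measurable_fun_pair; first exact: measurable_coord.
apply: measurable_fun_rV => j; under eq_fun do rewrite mxE.
exact: measurable_coord.
Qed.


Section cons_measure.
Variables (n : nat) (m : {sigma_finite_measure set 'rV[R]_n -> \bar R}).

Definition cons_measure : set 'rV[R]_n.+1 -> \bar R :=
  pushforward (@lebesgue_measure R \x m)%E (@cons_rV n).

Let mpre (A : set 'rV[R]_n.+1) : measurable A -> measurable (@cons_rV n @^-1` A).
Proof. by move=> mA; rewrite -[X in measurable X]setTI; exact: measurable_cons_rV. Qed.

Let cons_measure0 : cons_measure set0 = 0%E.
Proof. by rewrite /cons_measure /pushforward preimage_set0 measure0. Qed.

Let cons_measure_ge0 A : (0 <= cons_measure A)%E.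
Proof. by rewrite /cons_measure /pushforward; exact: measure_ge0. Qed.

Let cons_measure_sigma_additive : semi_sigma_additive cons_measure.
Proof.
move=> F mF tF mU; rewrite /cons_measure /pushforward preimage_bigcup.
apply: measure_semi_sigma_additive.
- by move=> i; exact: mpre.
- apply/trivIsetP => i j _ _ ij; rewrite -preimage_setI.
  by move/trivIsetP : tF => /(_ i j Logic.I Logic.I ij) ->; rewrite preimage_set0.
- by rewrite -preimage_bigcup; exact: mpre.
Qed.

HB.instance Definition _ := isMeasure.Build _ _ _ cons_measure
  cons_measure0 cons_measure_ge0 cons_measure_sigma_additive.

Let cons_measure_sigma_finite : sigma_finite setT cons_measure.
Proof.
have [F FT mF] : sigma_finite setT (@lebesgue_measure R \x m)%E.
  have /sigma_finiteP[F [TF ndF Foo]] := sigma_finiteT (@lebesgue_measure R).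
  have /sigma_finiteP[G [TG ndG Goo]] := sigma_finiteT m.
  exists (fun i => F i `*` G i).
    rewrite -setXTT TF TG predeqE => -[x y]; split.
      move=> [/= [i _ Fx] [k _ Gy]]; exists (maxn i k) => //; split.
      - by move: x Fx; exact/subsetPset/ndF/leq_maxl.
      - by move: y Gy; exact/subsetPset/ndG/leq_maxr.
    by move=> [i _ []/= ? ?]; split; exists i.
  move=> k; have [? ?] := Foo k; have [? ?] := Goo k.
  split; first exact: measurableX.
  by rewrite product_measure1E// lte_mul_pinfty// ge0_fin_numE.
exists (fun i => @uncons_rV n @^-1` F i).
  by rewrite -preimage_bigcup -FT preimage_setT.
move=> i; have [mFi Fi] := mF i; split.
  by rewrite -[X in measurable X]setTI; exact: measurable_uncons_rV.
rewrite /cons_measure /pushforward -comp_preimage.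
rewrite (_ : _ \o _ = id) ?preimage_id//.
by apply/funext => p; exact: cons_rVK.
Qed.

HB.instance Definition _ := Measure_isSigmaFinite.Build _ _ _ cons_measure
  cons_measure_sigma_finite.

End cons_measure.

Fixpoint lebesgue_rV n : {sigma_finite_measure set 'rV[R]_n -> \bar R} :=
  match n with
  | 0 => \d_(0 : 'rV[R]_0)
  | n.+1 => cons_measure (lebesgue_rV n)
  end.

Definition L2norm n (f : 'rV[R]_n -> R) : R :=
  Num.sqrt (\int[lebesgue_rV n]_t (f t ^+ 2)).

End lebesgue_rV.

Section random_fields.
Context {R : realType}.

Definition random_field d disp (T : measurableType disp) (X : T -> lfsbm R d) :=
  measurable_fun setT X.

Definition same_law d disp (T : measurableType disp) (P : probability T R)
    (X : T -> lfsbm R d) disp' (T' : measurableType disp')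
    (P' : probability T' R) (X' : T' -> lfsbm R d) :=
  forall A : set (lfsbm R d), measurable A -> P (X @^-1` A) = P' (X' @^-1` A).

Definition independent_fields d disp (T : measurableType disp)
    (P : probability T R) (X Y : T -> lfsbm R d) :=
  forall A B : set (lfsbm R d), measurable A -> measurable B ->
    P (X @^-1` A `&` Y @^-1` B) = (P (X @^-1` A) * P (Y @^-1` B))%E.

Definition stationary d disp (T : measurableType disp) (P : probability T R)
    (X : T -> lfsbm R d) :=
  forall s : 'rV[R]_d, same_law P (fun w => lfsbm_reindex 1%g s (X w)) P X.

Definition is_split d disp (T : measurableType disp) (P : probability T R)
    (X : T -> lfsbm R d) disp' (T' : measurableType disp')
    (P' : probability T' R) (X0 Xm Xp : T' -> lfsbm R d) :=
  [/\ random_field X0, random_field Xm, random_field Xp,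
      independent_fields P' Xm Xp &
      [/\ same_law P' X0 P X, same_law P' Xm P X & same_law P' Xp P X]].

Definition is_leak d disp (T : measurableType disp) (P : probability T R)
    (X : T -> lfsbm R d.+1) disp' (T' : measurableType disp')
    (P' : probability T' R) (Y : T' -> lfsbm R d.+1) :=
  random_field Y /\
  exists disp'' (T'' : measurableType disp'') (P'' : probability T'' R)
      (X0 Xm Xp : T'' -> lfsbm R d.+1),
    is_split P X P'' X0 Xm Xp /\
    same_law P' Y P'' (fun w => lfsbm_leak (X0 w) (Xm w) (Xp w)).

(* ([0,1)^k + s) x R^(d+1-k), for k <= d+1 *)
Definition slab d k (s : 'rV[R]_k) : set 'rV[R]_d.+1 :=
  [set t | forall j : 'I_k, s 0 j <= t 0 (inord j) < s 0 j + 1].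

Definition exp_variation d disp (T : measurableType disp) (P : probability T R)
    (X : T -> lfsbm R d) (A : set 'rV[R]_d) : \bar R :=
  (\int[P]_w expeR (lfsbm_variation (X w) A))%E.

End random_fields.

(* Coordinates are numbered from 0.  By perm_shiftE, the point
   perm_shift (rot_in i) (r *: delta_mx 0 i) t is
   (t_1, ..., t_i, t_0 + r, t_(i+1), ..., t_d) and the point
   perm_shift (rot_out i) 0 t is (t_i, t_0, ..., t_(i-1), t_(i+1), ..., t_d). *)
Definition rot_in d (i : 'I_d.+1) : 'S_d.+1 := lift_perm i ord0 1.
Definition rot_out d (i : 'I_d.+1) : 'S_d.+1 := lift_perm ord0 i 1.

Lemma rot_inE d (i j : 'I_d.+1) :
  rot_in i j = (if (j < i)%N then j.+1 else if j == i then 0%N else j) :> nat.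
Proof.
rewrite /rot_in; have [ij|ij|/val_inj ->] := ltngtP j i; last first.
- by rewrite eqxx lift_perm_id.
- case: (unliftP i j) ij => [j' ->|->]; last by rewrite ltnn.
  by rewrite eq_sym -if_neg neq_lift lift_perm_lift perm1 lift0 /= /bump; lia.
- case: (unliftP i j) ij => [j' ->|->]; last by rewrite ltnn.
  by rewrite lift_perm_lift perm1 lift0 /= /bump; lia.
Qed.

Lemma rot_outE d (i j : 'I_d.+1) :
  rot_out i j = (if j == ord0 then i : nat else if (j <= i)%N then j.-1 else j) :> nat.
Proof.
rewrite /rot_out; case: (unliftP ord0 j) => [j' ->|->]; last first.
  by rewrite eqxx lift_perm_id.
rewrite eq_sym (negbTE (neq_lift _ _)) lift_perm_lift perm1 lift0 /= /bump.
by case: (leqP i j').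
Qed.

Section splittability.
Context {R : realType} {d : nat}.

(* (1,k)-splittability.  The value at k = 0 is the terminal condition in the
   clause for k = 1; it makes the two cases of (c) uniform. *)
Fixpoint splittable1 (k : nat) disp (T : measurableType disp)
    (P : probability T R) (X : T -> lfsbm R d.+1) : Prop :=
  match k with
  | 0 => (exp_variation P X setT <= 2%:E)%E
  | k'.+1 =>
    [/\ forall s : 'rV[R]_k, (exp_variation P X (slab s) <= 2%:E)%E,
        forall A, bounded_borel A -> ('E_P[fun w => X w A] = 0)%E &
        forall (i : 'I_d.+1) (r : R), (i < k)%N ->
          exists disp' (T' : measurableType disp') (P' : probability T' R)
              (Y : T' -> lfsbm R d.+1),
            is_leak P
              (fun w => lfsbm_reindex (rot_in i) (r *: delta_mx 0 i) (X w)) P' Y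
            /\ splittable1 k' P'
              (fun w => lfsbm_reindex (rot_out (inord k')) 0 (Y w))]
  end.

Definition splittable disp (T : measurableType disp) (P : probability T R)
    (X : T -> lfsbm R d.+1) :=
  exists C : R, 0 < C /\
    splittable1 d.+1 P (fun w => lfsbm_scale C^-1 (X w)).

Definition rescale (r : R) (phi : 'rV[R]_d.+1 -> R) (t : 'rV[R]_d.+1) : R :=
  phi (r^-1 *: t).

(* As lne +oo = +oo, the exponential moments are required to be finite in the
   regime considered. *)
Definition is_sigma disp (T : measurableType disp) (P : probability T R)
    (X : T -> lfsbm R d.+1) (sigma : R) :=
  0 <= sigma /\
  forall phi, Cc R d.+1 phi ->
  forall eta : R, 0 < eta -> exists r0 delta : R, [/\ 0 < r0, 0 < delta &
    forall r lambda : R, r0 < r -> 0 < `|lambda| < delta ->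
      `|lambda| * ln r ^+ d.+1 < delta ->
      (`| (r ^+ d.+1 * lambda ^+ 2)^-1%:E *
          lne ('E_P[fun w => expR (lambda * lfsbm_int (X w) (rescale r phi))])
          - (2^-1 * L2norm phi ^+ 2 * sigma ^+ 2)%:E | < eta%:E)%E].

End splittability.

(* Main.v *)
(** Gaertner-Ellis argument: taking [lambda = c / (||phi|| sigma r^(d/2))] in the
    definition of [sigma_X] gives, for bounded [t > 0] and with
    [Z := (||phi|| sigma r^(d/2))^-1 * int phi(t/r) X_t dt], the asymptotics
    [log E exp(t c Z) = c^2 (t^2/2 + o(1))].  Chernoff's inequality at [t = 1] is
    the upper bound.  For the lower bound, tilt by [t = 1 + e]: under the tilted law
    [Z / c] concentrates near [1 + e], since the contributions of [Z < c] and
    [Z > (1 + 2e) c] are controlled by the exponential moments at [1] and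
    [1 + 2e]; on the remaining event [exp(t c Z) <= exp(t (1 + 2e) c^2)]. *)
Require Import Defs.
From HB Require Import structures.
From mathcomp Require Import all_boot all_order all_algebra all_fingroup.
From mathcomp Require Import ring lra.
From mathcomp Require Import all_classical all_reals all_analysis.
From mathcomp Require Import measurable_realfun.

Set Implicit Arguments.
Unset Strict Implicit.
Unset Printing Implicit Defensive.

Import Order.TTheory GRing.Theory Num.Theory.
Import numFieldNormedType.Exports.

Local Open Scope classical_set_scope.
Local Open Scope ring_scope.

(** [lne] takes the value [-oo] at nonpositive arguments and [+oo] at [+oo]; since [k > 0], either
    value would put the left side at infinite distance from [a]. So the bound alone forces [x] to be
    finite and positive. *)
Lemma lne_fin_dist (R : realType) (k a e : R) (x : \bar R) : 0 < k ->
  (`|k%:E * lne x - a%:E| < e%:E)%E ->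
  exists2 l : R, x = (expR l)%:E & `|k * l - a| < e.
Proof.
move=> k0; case: x => [x| |] /=; last 2 first.
- by rewrite gt0_muley ?lte_fin.
- by rewrite gt0_muleNy ?lte_fin.
have [x0|x0] := leP x 0; first by rewrite gt0_muleNy ?lte_fin.
rewrite -EFinM -EFinB lte_fin => ke; exists (ln x) => //.
by rewrite lnK.
Qed.

Section exponential_tail.
Context {R : realType} disp (T : measurableType disp) (P : probability T R).
Variables (S : T -> R) (mS : measurable_fun setT S).

Local Notation mgf t := ('E_P[fun w => expR (t * S w)])%E.

Let mexp (t : R) : measurable_fun setT (fun w => (expR (t * S w))%:E).
Proof.
apply/measurable_EFinP; apply: measurableT_comp; first exact: measurable_expR.
exact: measurable_funM.
Qed.

Let mtail (a : R) : measurable [set w | a <= S w].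
Proof.
rewrite (_ : [set w | _] = S @^-1` `[a, +oo[); last first.
  by apply/seteqP; split => w /=; rewrite in_itv /= andbT.
by rewrite -[X in measurable X]setTI; exact: mS.
Qed.

Lemma tail_le_mgf (a t : R) : 0 < t ->
  (P [set w | a <= S w]%R <= (expR (- (t * a)))%:E * mgf t)%E.
Proof.
move=> t0; have := chernoff (P := P) (mfun_Sub (mem_set mS)) a t0.
rewrite /mmt_gen_fun muleC; congr (_ <= _ * 'E_P[_])%E.
by apply/funext => w /=; rewrite mulrC.
Qed.

(** Pointwise bound of [expR (t * S)] over three ranges. For [S < a] use [s * (a - S) >= 0], for
    [S > b] use [s * (S - b) >= 0], and in between bound [S] by [b]; each range uses one summand,
    the others being nonnegative. *)
Lemma mgf_le_tail (a b s t : R) : 0 <= s -> 0 <= t ->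
  (mgf t <= (expR (t * b))%:E * P [set w | a <= S w]%R +
            (expR (s * a))%:E * mgf (t - s)%R +
            (expR (- (s * b)))%:E * mgf (t + s)%R)%E.
Proof.
move=> s0 t0; rewrite unlock.
have mind : measurable_fun setT
    (fun w => (\1_[set w | a <= S w] w : R)%:E).
  exact/measurable_EFinP/measurable_indic.
rewrite -[X in P X]setIT -integral_indic//.
rewrite -!ge0_integralZl_EFin ?expR_ge0//.
have mZ (k : R) (f : T -> \bar R) : measurable_fun setT f ->
  measurable_fun setT (fun w => k%:E * f w)%E by exact: measurable_funeM.
have Z0 (k x : R) : 0 <= x -> (0 <= (expR k)%:E * x%:E)%E.
  by move=> x0; rewrite -EFinM lee_fin mulr_ge0// expR_ge0.
rewrite -!ge0_integralD//; first last.
- by apply: mZ; exact: mexp.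
- exact: mZ.
- by apply: mZ; exact: mexp.
- by apply: emeasurable_funD; apply: mZ => //; exact: mexp.
- by move=> w _; apply: adde_ge0; apply: Z0 => //; exact: expR_ge0.
apply: ge0_le_integral => //.
  apply: emeasurable_funD; last by apply: mZ; exact: mexp.
  by apply: emeasurable_funD; apply: mZ => //; exact: mexp.
move=> w _; rewrite -!EFinM -!EFinD lee_fin -!expRD.
have [wa|aw] := ltP (S w) a.
  apply: (@le_trans _ _ (expR (s * a + (t - s) * S w))); first by rewrite ler_expR; nra.
  by rewrite addrAC lerDr addr_ge0// mulr_ge0 ?expR_ge0.
have [wb|bw] := leP (S w) b.
  rewrite indicE mem_set// mulr1 -addrA.
  apply: (@le_trans _ _ (expR (t * b))); first by rewrite ler_expR; nra.
  by rewrite lerDl addr_ge0// expR_ge0.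
apply: (@le_trans _ _ (expR (- (s * b) + (t + s) * S w))); first by rewrite ler_expR; nra.
by rewrite lerDr addr_ge0// ?mulr_ge0 ?expR_ge0.
Qed.

(** The tilting argument in non-asymptotic form: [lambda * a] plays the role of [c ^+ 2], and [e] is
    both the excess tilt and the scale of the final error. *)
Lemma gaussian_mgf_tail (lambda a e : R) :
  0 < lambda -> 0 < e <= 1 -> 12 <= lambda * a * e ^+ 2 ->
  (forall t, 1 <= t <= 3 -> exists2 l, mgf (t * lambda)%R = (expR l)%:E &
     `|(lambda * a)^-1 * l - t ^+ 2 / 2| <= e ^+ 2 / 8) ->
  (`|(lambda * a)^-1%:E * lne (P [set w | a <= S w]%R) - (- 2^-1)%:E|
     <= (4 * e)%:E)%E.
Proof.
move=> l0 /andP[e0 e1]; set k := lambda * a => ke H.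
have k0 : 0 < k by nra.
have {}H t : 1 <= t <= 3 -> exists2 l, mgf (t * lambda)%R = (expR l)%:E &
    k * (t ^+ 2 / 2 - e ^+ 2 / 8) <= l <= k * (t ^+ 2 / 2 + e ^+ 2 / 8).
  move=> /H[l El]; rewrite ler_distl => /andP[h1 h2]; exists l => //.
  by rewrite -ler_pdivlMl// h1 -ler_pdivrMl.
(* Only three exponents are needed: 1 (Chernoff and the left part), [1 + e] (the tilt), [1 + 2 * e]
   (the right part). *)
have := H 1; rewrite lexx ler1n => /(_ isT)[l1 E1 /andP[_ l1k]].
rewrite mul1r in E1.
have t2 : 1 <= 1 + e <= 3 by apply/andP; split; lra.
have [l2 E2 /andP[l2k _]] := H _ t2.
have t3 : 1 <= 1 + 2 * e <= 3 by apply/andP; split; lra.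
have [l3 E3 /andP[_ l3k]] := H _ t3.
have up := tail_le_mgf a l0.
have el0 : 0 <= e * lambda by nra.
have tl0 : 0 <= (1 + e) * lambda by nra.
have := mgf_le_tail a ((1 + 2 * e) * a) el0 tl0.
have -> : (1 + e) * lambda - e * lambda = lambda by ring.
have -> : (1 + e) * lambda + e * lambda = (1 + 2 * e) * lambda by ring.
have : P [set w | a <= S w]%R \is a fin_num by exact: fin_num_measure.
move: up; rewrite E1 E2 E3 -/k.
move: (P _) => [p| |]//= + _.
rewrite -!EFinM -!EFinD !lee_fin -!expRD => up lo.
have {}up : p <= expR (- k * (2^-1 - e ^+ 2 / 8)).
  by apply: le_trans up _; rewrite ler_expR; nra.
(* The window from [a] to [(1 + 2 * e) * a] is centred at the tilted mean [(1 + e) * a], so both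
   outer contributions have this same exponent bound. *)
pose m := k * (2^-1 + e + e ^+ 2 / 8).
have m1 : expR (e * lambda * a + l1) <= expR m by rewrite ler_expR /m/k in l1k *; nra.
have m3 : expR (- (e * lambda * ((1 + 2 * e) * a)) + l3) <= expR m.
  by rewrite ler_expR /m/k in l3k *; nra.
(* The lower bound on [l2] exceeds [m] by [k * e ^+ 2 / 4 >= 3], which is where 12 comes from, and
   [expR 3 >= 1 + 3]. The outer terms then take at most half of [expR l2]. *)
have m2 : 4 * expR m <= expR l2.
  apply: (@le_trans _ _ (expR (k * e ^+ 2 / 4 + m))); last first.
    by rewrite ler_expR /m; nra.
  rewrite expRD ler_pM2r ?expR_gt0//; apply: le_trans (expR_ge1Dx _); lra.
have {}lo : expR (- k * (2^-1 + 4 * e)) <= p.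
  have q : expR ((1 + e) * lambda * ((1 + 2 * e) * a)) * p >= expR m.
    by have := expR_ge0 m; lra.
  rewrite -(@ler_pM2l _ (expR ((1 + e) * lambda * ((1 + 2 * e) * a)))) ?expR_gt0//.
  apply: le_trans q; rewrite -expRD ler_expR /m.
  have -> : (1 + e) * lambda * ((1 + 2 * e) * a) = k * (1 + 3 * e + 2 * e ^+ 2).
    by rewrite /k; ring.
  nra.
have p0 : 0 < p by apply: lt_le_trans lo; exact: expR_gt0.
have /negbTE -> : ~~ (p <= 0) by rewrite -ltNge.
rewrite -EFinM -EFinB lee_fin ler_distl.
have lnlo : - k * (2^-1 + 4 * e) <= ln p by rewrite -ler_expR lnK.
have lnup : ln p <= - k * (2^-1 - e ^+ 2 / 8) by rewrite -ler_expR lnK.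
rewrite ler_pdivlMl// ler_pdivrMl//; apply/andP; split; nra.
Qed.

End exponential_tail.

Lemma Cc_rescale (R : realType) (d : nat) (r : R) (phi : 'rV[R]_d.+1 -> R) :
  0 < r -> Cc R d.+1 phi -> Cc R d.+1 (rescale r phi).
Proof.
move=> r0 [cphi sphi]; split.
  move=> t; rewrite /rescale.
  have h := @scaler_continuous R 'rV[R]_d.+1 r^-1 t.
  exact: (cvg_comp _ _ h (cphi _)).
pose K := [set r *: t | t in closure [set t | phi t != 0]].
have cK : compact K.
  apply: continuous_compact => //; apply: continuous_subspaceT.
  exact: scaler_continuous.
apply: (subclosed_compact _ cK); first exact: closed_closure.
rewrite closureE; apply: smallest_sub.
  by apply: compact_closed => //; exact: norm_hausdorff.
move=> t /= pt; exists (r^-1 *: t); first exact: subset_closure.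
by rewrite scalerA divff ?gt_eqF// scale1r.
Qed.

Lemma measurable_lfsbm_int (R : realType) (d : nat) disp (T : measurableType disp)
    (X : T -> lfsbm R d) (f : 'rV[R]_d -> R) :
  random_field X -> Cc R d f -> measurable_fun setT (fun w => lfsbm_int (X w) f).
Proof.
move=> mX Cf _ B mB.
have mA : measurable [set mu : lfsbm R d | B (lfsbm_int mu f)].
  by apply: sub_sigma_algebra; exists f => //; exists B.
exact: mX measurableT _ mA.
Qed.

(* The dimension is d.+1. *)
Theorem corollary1p6 (R : realType) (d : nat)
    (disp : measure_display) (T : measurableType disp) (P : probability T R)
    (X : T -> lfsbm R d.+1) (X_field : random_field X)
    (X_splittable : splittable P X) (X_stationary : stationary P X)
    (phi : 'rV[R]_d.+1 -> R) (phi_Cc : Cc R d.+1 phi)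
    (sigma : R) (X_sigma : is_sigma P X sigma)
    (phi_sigma_neq0 : L2norm phi * sigma != 0) :
  forall eta : R, 0 < eta -> exists r0 delta : R, [/\ 0 < r0, 0 < delta &
    forall r c : R, r0 < r -> r0 < c ->
      (c * ln r ^+ d.+1) ^+ 2 / r ^+ d.+1 < delta ->
      (`| (c ^+ 2)^-1%:E *
          lne (P [set w | c * L2norm phi * sigma * r `^ (d.+1%:R / 2) <=
                          lfsbm_int (X w) (rescale r phi)]%R)
          - (- 2^-1)%:E | < eta%:E)%E].
Proof.
move=> eta eta0; set M := L2norm phi * sigma.
have [sigma0 sig] := X_sigma.
have M0 : 0 < M by rewrite lt_def phi_sigma_neq0 mulr_ge0 ?sqrtr_ge0.
(* Dividing by 5 turns the non-strict error [4 * e] into a strict bound by [eta]. *)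
pose e := Num.min 1 (eta / 5).
have e0 : 0 < e by rewrite lt_min ltr01 divr_gt0.
have e1 : e <= 1 by rewrite ge_min lexx.
have e5 : e <= eta / 5 by rewrite ge_min lexx orbT.
(* Normalising multiplies the error by [t ^+ 2 / M ^+ 2] with [t ^+ 2 <= 9]; hence [M ^+ 2] and
   [72 = 9 * 8], leaving [e ^+ 2 / 8]. *)
have eta'0 : 0 < M ^+ 2 * e ^+ 2 / 72 by rewrite divr_gt0// mulr_gt0// exprn_gt0.
have [r0 [delta [r00 delta0 {}sig]]] := sig phi phi_Cc _ eta'0.
(* [expR 1] ensures [ln r >= 1] and [c > 1]; with [c > 12 / e ^+ 2] this gives
   [c ^+ 2 * e ^+ 2 >= 12]. The 3 in the second witness absorbs [t <= 3]. *)
exists (Num.max r0 (Num.max (expR 1) (12 / e ^+ 2))), ((delta * M / 3) ^+ 2); split.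
- by rewrite lt_max r00.
- by rewrite exprn_gt0// divr_gt0// mulr_gt0.
move=> r c; rewrite !gt_max => /and3P[r0r er _] /and3P[r0c ec ce] rc.
have r_gt0 : 0 < r by exact: lt_trans r0r.
have c0 : 0 < c by exact: lt_trans r0c.
have c1 : 1 < c by apply: lt_trans ec; rewrite expR_gt1.
have lnr : 1 <= ln r ^+ d.+1.
  by apply: exprn_ege1; rewrite -ler_expR lnK// ltW.
set rho := r `^ (d.+1%:R / 2).
have rho0 : 0 < rho by exact: powR_gt0.
have rho2 : rho ^+ 2 = r ^+ d.+1.
  by rewrite -powR_mulrn ?powR_ge0// -powRrM divfK// powR_mulrn// ltW.
have {}rc : c * ln r ^+ d.+1 < delta * M / 3 * rho.
  rewrite -(@ltr_pXn2r _ 2)// ?nnegrE; last 2 first.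
  - by rewrite mulr_ge0 ?(ltW c0)// (le_trans ler01).
  - by rewrite mulr_ge0 ?ltW// divr_gt0// mulr_gt0.
  by rewrite [ltRHS]exprMn rho2 -ltr_pdivrMr// exprn_gt0.
have Mrho0 : 0 < M * rho := mulr_gt0 M0 rho0.
pose lambda := c / (M * rho).
have lambda0 : 0 < lambda by exact: divr_gt0.
have la : lambda * (c * M * rho) = c ^+ 2.
  by rewrite /lambda; field; rewrite ?gt_eqF.
have -> : c * L2norm phi * sigma * rho = c * M * rho by rewrite /M mulrA.
have eta4 : 4 * e < eta by lra.
apply: le_lt_trans (_ : (4 * e)%:E < eta%:E)%E; last by rewrite lte_fin.
rewrite -la; apply: gaussian_mgf_tail => //.
- by apply: measurable_lfsbm_int => //; exact: Cc_rescale.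
- by rewrite e0.
- rewrite la; rewrite ltr_pdivrMr ?exprn_gt0// in ce.
  by apply: le_trans (ltW ce) _; rewrite ler_pM2r ?exprn_gt0//; nra.
move=> t /andP[t1 t3]; rewrite la.
have t0 : 0 < t by lra.
have tl0 : 0 < t * lambda by exact: mulr_gt0.
have tlD : t * lambda * ln r ^+ d.+1 < delta.
  apply: (@le_lt_trans _ _ (3 * (c * ln r ^+ d.+1) / (M * rho))).
    rewrite (_ : t * _ * _ = t * (c * ln r ^+ d.+1) / (M * rho)); last first.
      by rewrite /lambda; ring.
    have cl0 : 0 < c * ln r ^+ d.+1 by rewrite mulr_gt0// (lt_le_trans ltr01).
    apply: ler_wpM2r; first by rewrite invr_ge0 ltW.
    exact: ler_wpM2r (ltW cl0) _ _ t3.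
  rewrite ltr_pdivrMr//.
  rewrite (_ : delta * _ = 3 * (delta * M / 3 * rho)); last by field.
  by rewrite ltr_pM2l.
(* As [ln r ^+ d.+1 >= 1], smallness of [t * lambda] follows from that of its product with the
   logarithmic factor. *)
have tld : t * lambda < delta by apply: le_lt_trans tlD; rewrite ler_pMr.
have := sig r (t * lambda) r0r; rewrite gtr0_norm// tl0 tld => /(_ isT tlD).
have -> : r ^+ d.+1 * (t * lambda) ^+ 2 = t ^+ 2 * c ^+ 2 / M ^+ 2.
  by rewrite -rho2 /lambda; field; rewrite !gt_eqF.
have D0 : 0 < t ^+ 2 * c ^+ 2 / M ^+ 2.
  by rewrite divr_gt0// ?exprn_gt0// mulr_gt0// exprn_gt0.
move=> /lne_fin_dist[]; first by rewrite invr_gt0.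
move=> l El hl; exists l => //.
have M2 : 2^-1 * L2norm phi ^+ 2 * sigma ^+ 2 = 2^-1 * M ^+ 2.
  by rewrite -mulrA -exprMn.
rewrite {}M2 in hl.
have -> : (c ^+ 2)^-1 * l - t ^+ 2 / 2 = t ^+ 2 / M ^+ 2 *
    ((t ^+ 2 * c ^+ 2 / M ^+ 2)^-1 * l - 2^-1 * M ^+ 2).
  by field; rewrite (gt_eqF M0) (gt_eqF c0) (gt_eqF t0).
have tM : 0 < t ^+ 2 / M ^+ 2 by rewrite divr_gt0 ?exprn_gt0.
rewrite normrM (gtr0_norm tM).
apply: (@le_trans _ _ (t ^+ 2 / M ^+ 2 * (M ^+ 2 * e ^+ 2 / 72))).
  by apply: ler_wpM2l; exact: ltW.
have -> : t ^+ 2 / M ^+ 2 * (M ^+ 2 * e ^+ 2 / 72) = t ^+ 2 * (e ^+ 2 / 72).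
  by field; rewrite (gt_eqF M0).
have e72 : 0 < e ^+ 2 / 72 by rewrite divr_gt0// exprn_gt0.
have t9 : t ^+ 2 <= 9 by nra.
apply: le_trans (ler_wpM2r (ltW e72) t9) _; lra.
Qed.
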